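(* Assume that $P_X \ll \nu$, where $\nu(dx)=\nu_1(dx_1)\otimes\cdots\otimes\nu_p(dx_p)$, and that there exists $0<M\le 1$ such that for every $u\subseteq \{1,\dots,p\}$, $p_X \ge M\, p_{X_u}p_{X_{u^c}}$ $\nu$-a.e. Let $\eta\in L^2_{\mathbb R}(\mathbb R^p,\mathcal B(\mathbb R^p),P_X)$ and $Y=\eta(\mathbf X)$ with $V(Y)\ne 0$. Then the generalized sensitivity indices $S_u$, $u\in S\setminus\{\emptyset\}$, sum to $1$: $$\sum_{u\in S\setminus\{\emptyset\}}S_u=1.$$
   Context: Let $(\Omega,\mathcal A,P)$ be a probability space, $p\ge 1$, $\mathbf X=(X_1,\dots,X_p)$ a random vector in $\mathbb R^p$ with law $P_X$. $\nu$ is a $\sigma$-finite measure on $(\mathbb R^p,\mathcal B(\mathbb R^p))$ and $p_X=dP_X/d\nu$. $S$ is the collection of all subsets of $\{1,\dots,p\}$. For $u\in S$, $X_u=(X_l)_{l\in u}$, $u^c$ is the complement of $u$ in $\{1,\dots,p\}$, and $p_{X_u}$ is the marginal density of $X_u$ with respect to $\bigotimes_{l\in u}\nu_l$ (with $p_{X_\emptyset}=1$). $V$ and $\mathrm{Cov}$ denote variance and covariance. The inner product of $L^2_{\mathbb R}(\mathbb R^p,\mathcal B(\mathbb R^p),P_X)$ is $\langle h_1,h_2\rangle=\mathbb E(h_1(\mathbf X)h_2(\mathbf X))$. Functions are identified when equal $P_X$-a.s. $H_u$ is the subspace of square integrable measurable functions depending only on $X_u$; $H_\emptyset$ is the set of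 constants and $H_\emptyset^0=H_\emptyset$. For $u\in S\setminus\{\emptyset\}$, recursively, $$H_u^0=\{h_u(X_u)\in H_u:\ \langle h_u,h_v\rangle=0\ \ \forall v\subset u,\ \forall h_v\in H_v^0\},$$ where $\subset$ denotes strict inclusion. Under the assumptions of the claim there is a unique family $(\eta_u)_{u\in S}$ with $\eta_u\in H_u^0$ for all $u\in S$ and $\eta(\mathbf X)=\sum_{u\in S}\eta_u(X_u)$. For $u\in S\setminus\{\emptyset\}$ the generalized sensitivity index is $$S_u=\frac{V(\eta_u(X_u))+\sum_{v\in S:\ u\cap v\ne u,\ u\cap v\neq v}\mathrm{Cov}(\eta_u(X_u),\eta_v(X_v))}{V(Y)}.$$ *)

(* Defs.v *)
From HB Require Import structures.
From mathcomp Require Import all_boot all_order all_algebra.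
From mathcomp Require Import all_classical all_reals all_analysis.

Set Implicit Arguments.
Unset Strict Implicit.
Unset Printing Implicit Defensive.

Import Order.TTheory GRing.Theory Num.Theory.
Import numFieldNormedType.Exports.

Local Open Scope classical_set_scope.
Local Open Scope ring_scope.
Local Open Scope charge_scope.

(* R^n is n.-tuple R with the product sigma-algebra of the Borel sets of R,
   which is the Borel sigma-algebra of R^n. *)

Section product_measure_tuple.
Context d (T : measurableType d) (R : realType).
Local Open Scope ereal_scope.

Definition cons_pair n (x : T * n.-tuple T) : n.+1.-tuple T :=
  [tuple of x.1 :: x.2].

Lemma measurable_cons_pair n : measurable_fun [set: T * n.-tuple T] (@cons_pair n).
Proof. exact: (measurable_cons measurable_fst measurable_snd). Qed.

HB.instance Definition _ n :=
  isMeasurableFun.Build _ _ _ _ (@cons_pair n) (@measurable_cons_pair n).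

Section step.
Variables (n : nat) (m : {sigma_finite_measure set T -> \bar R}).
Variable (mn : {sigma_finite_measure set (n.-tuple T) -> \bar R}).

Definition product_step : set (n.+1.-tuple T) -> \bar R :=
  pushforward (m \x mn) (@cons_pair n).

Let product_step0 : product_step set0 = 0.
Proof. exact: measure0. Qed.

Let product_step_ge0 A : 0 <= product_step A.
Proof. exact: measure_ge0. Qed.

Let product_step_sigma_additive : semi_sigma_additive product_step.
Proof.
have mf := @measurable_cons_pair n.
move=> F mF tF mUF; rewrite /product_step /pushforward preimage_bigcup.
apply: measure_semi_sigma_additive.
- by move=> i; rewrite -[X in measurable X]setTI; exact: mf.
- apply/trivIsetP => /= i j _ _ ij; rewrite -preimage_setI.
  by move/trivIsetP : tF => /(_ _ _ _ _ ij) ->//; rewrite preimage_set0.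
- by rewrite -preimage_bigcup -[X in measurable X]setTI; exact: mf.
Qed.

HB.instance Definition _ := isMeasure.Build _ _ _ product_step
  product_step0 product_step_ge0 product_step_sigma_additive.

Let product_step_sigma_finite : sigma_finite setT product_step.
Proof.
have /sigma_finiteP[F [TF ndF Foo]] := sigma_finiteT m.
have /sigma_finiteP[G [TG ndG Goo]] := sigma_finiteT mn.
pose K i : set (n.+1.-tuple T) :=
  [set t | F i (thead t) /\ G i [tuple of behead t]].
exists K.
  apply/esym; rewrite -subTset => t _.
  have [k _ Fk] : (\bigcup_i F i) (thead t) by rewrite -TF.
  have [l _ Gl] : (\bigcup_i G i) [tuple of behead t] by rewrite -TG.
  exists (maxn k l) => //; split.
  - by move: Fk; exact/subsetPset/ndF/leq_maxl.
  - by move: Gl; exact/subsetPset/ndG/leq_maxr.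
move=> i; have [mF Fi] := Foo i; have [mG Gi] := Goo i; split.
  apply: measurableI; rewrite -[X in measurable X]setTI.
  - by apply: measurable_tnth.
  - by apply: measurable_behead.
rewrite /product_step /pushforward (_ : _ @^-1` _ = F i `*` G i).
  by rewrite product_measure1E// lte_mul_pinfty// ge0_fin_numE.
have bK x : [tuple of behead (@cons_pair n x)] = x.2 by exact/val_inj.
by apply/seteqP; split => x; rewrite /K/= bK.
Qed.

HB.instance Definition _ :=
  @Measure_isSigmaFinite.Build _ _ _ product_step product_step_sigma_finite.

End step.

Fixpoint product_measure n :
    ('I_n -> {sigma_finite_measure set T -> \bar R}) ->
    {sigma_finite_measure set (n.-tuple T) -> \bar R} :=
  match n with
  | 0 => fun=> \d_([tuple] : 0.-tuple T)
  | n'.+1 => fun m =>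
      product_step (m ord0) (product_measure (fun i => m (lift ord0 i)))
  end.

Lemma product_measureE n (m : 'I_n -> {sigma_finite_measure set T -> \bar R})
    (A : 'I_n -> set T) : (forall i, measurable (A i)) ->
  product_measure m [set t | forall i, A i (tnth t i)] =
  \big[*%E/1]_(i < n) m i (A i).
Proof.
elim: n m A => [|n IH] m A mA /=.
  by rewrite big_ord0 diracE mem_set//= => -[].
rewrite big_ord_recl -IH// -product_measure1E//; last first.
  rewrite (_ : [set t | _] =
    \bigcap_(i in [set: 'I_n]) ((@tnth n T)^~ i @^-1` A (lift ord0 i))).
    apply: fin_bigcap_measurable => // i _.
    by rewrite -[X in measurable X]setTI; exact: measurable_tnth.
  by apply/seteqP; split => t /= h i; [move=> _; exact: h | exact: (h i I)].
rewrite /product_step /pushforward; congr (_ _).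
apply/seteqP; split => -[x t]/= h.
  by split=> [|i]; [exact: (h ord0) | have := h (lift ord0 i); rewrite tnthS].
by move=> i; case: (unliftP ord0 i) => [j|] ->; rewrite ?tnthS; case: h.
Qed.

End product_measure_tuple.

Section coordinates.
Context d (T : measurableType d) (p : nat).

(* x |-> x_u = (x_l)_{l in u}; enum_val lists u in increasing order. *)
Definition coords (u : {set 'I_p}) (x : p.-tuple T) : #|u|.-tuple T :=
  [tuple tnth x (enum_val k) | k < #|u|].

Lemma measurable_coords u : measurable_fun [set: p.-tuple T] (coords u).
Proof.
apply/measurable_fun_tnthP => i.
rewrite (_ : _ \o _ = (@tnth p T)^~ (enum_val i)); first exact: measurable_tnth.
by apply/funext => x /=; rewrite tnth_mktuple.
Qed.

HB.instance Definition _ u :=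
  isMeasurableFun.Build _ _ _ _ (coords u) (@measurable_coords u).

End coordinates.

Section sensitivity.
Context d (T : measurableType d) (R : realType) (P : probability T R) (p : nat).
Variable X : {RV P >-> p.-tuple R}.
Implicit Types (u v : {set 'I_p}) (h : p.-tuple R -> R).

Section densities.
Variable nu : 'I_p -> {sigma_finite_measure set R -> \bar R}.

(* 'd _ '/d _ is a genuine density only under absolute continuity; when P_X
   is dominated by the product measure, so is the law of each X_u by the
   corresponding product over u. For u empty, the law of X_u and the empty
   product are both the unit mass, so the marginal density is 1. *)
Definition joint_density : p.-tuple R -> \bar R :=
  'd (charge_of_finite_measure (distribution P X)) '/d (product_measure nu).

Definition marginal_density u : #|u|.-tuple R -> \bar R :=
  'd (charge_of_finite_measure (distribution P (coords u \o X)))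
  '/d (product_measure (fun k : 'I_#|u| => nu (enum_val k))).

End densities.

Definition inner h1 h2 : \bar R := 'E_P[(h1 \o X) * (h2 \o X)]%E.

(* Functions are identified modulo P_X-a.s. equality: hence the
   factorization through x_u is only required almost surely. For u empty,
   g is defined on a one-point space, so these are the a.s. constants. *)
Definition H u : set (p.-tuple R -> R) :=
  [set h | h \in Lfun (distribution P X) 2%:E /\
    exists2 g : #|u|.-tuple R -> R, measurable_fun setT g &
      {ae distribution P X, forall x, h x = g (coords u x)}].

(* Recursion on the cardinal: H0_rec n u is only meant for #|u| <= n, where
   it does not depend on n. *)
Fixpoint H0_rec n u : set (p.-tuple R -> R) :=
  match n with
  | 0 => H u
  | n'.+1 => [set h | H u h /\
      forall v, v \proper u -> forall hv, H0_rec n' v hv -> inner h hv = 0%E]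
  end.

Definition H0 u := H0_rec #|u| u.

Lemma H0_recE n u : (#|u| <= n)%N -> H0_rec n u = H0 u.
Proof.
suff E k m (w : {set 'I_p}) : (#|w| <= k)%N -> (#|w| <= m)%N -> H0_rec k w = H0_rec m w.
  by move=> un; exact: E.
elim: k m w => [|k IH] [|m] w //=.
- rewrite leqn0 cards_eq0 => /eqP -> _; apply/seteqP; split => h //=; last by case.
  by split=> // v /proper_card; rewrite cards0.
- move=> _; rewrite leqn0 cards_eq0 => /eqP ->; apply/seteqP.
  split => h /=; first by case.
  by split=> // v /proper_card; rewrite cards0.
- move=> wk wm; apply/seteqP; split => h [Hh hv]; split=> // v vw g gv;
    apply: (hv v vw); have vlt := leq_trans (proper_card vw).
  + by rewrite (IH m)//; rewrite -ltnS; exact: vlt.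
  + by rewrite -(IH m)//; rewrite -ltnS; exact: vlt.
Qed.

Lemma H0_set0 : H0 finset.set0 = H finset.set0.
Proof. by rewrite /H0 cards0. Qed.

Lemma H0E u : H0 u = [set h | H u h /\
  forall v, v \proper u -> forall hv, H0 v hv -> inner h hv = 0%E].
Proof.
rewrite -(@H0_recE #|u|.+1)//=; apply/seteqP.
split => h [Hh hv]; split=> // v vu g gv; apply: (hv v vu).
- by rewrite H0_recE// ltnW// proper_card.
- by rewrite -(@H0_recE #|u|)// ltnW// proper_card.
Qed.

Definition hoeffding_decomposition (eta : p.-tuple R -> R)
    (eta_ : {set 'I_p} -> p.-tuple R -> R) : Prop :=
  (forall u, H0 u (eta_ u)) /\
  {ae P, forall w, eta (X w) = \sum_(u : {set 'I_p}) eta_ u (X w)}.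

(* Meant for eta_ the decomposition of eta; all variances and covariances are
   then finite, so that fine loses nothing. *)
Definition sensitivity_index (eta : p.-tuple R -> R)
    (eta_ : {set 'I_p} -> p.-tuple R -> R) u : R :=
  (fine 'V_P[eta_ u \o X] +
   \sum_(v : {set 'I_p} | (u :&: v != u) && (u :&: v != v))
      fine (covariance P (eta_ u \o X) (eta_ v \o X)))
  / fine 'V_P[eta \o X].

End sensitivity.

(* Main.v *)
Require Import Defs.
From mathcomp Require Import all_boot all_order all_algebra.
From mathcomp Require Import all_classical all_reals all_analysis.
From mathcomp Require Import measurable_realfun.

Set Implicit Arguments.
Unset Strict Implicit.
Unset Printing Implicit Defensive.

Import Order.TTheory GRing.Theory Num.Theory.
Import numFieldNormedType.Exports.

Local Open Scope classical_set_scope.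
Local Open Scope ring_scope.

(** The indices sum to 1 because they are what remains of the expansion of the
    variance of Y by bilinearity. Almost surely Y is the sum of the components
    eta_u(X_u), so V(Y) is the sum of Cov(eta_u(X_u), eta_v(X_v)) over all
    pairs (u, v). Hierarchical orthogonality removes most of these pairs.
    If v is strictly included in u, then E(eta_u eta_v) = 0 by definition of
    H_u^0; as 1 belongs to H_emptyset^0, also E(eta_u) = 0, so the covariance
    vanishes ([covariance_H0_proper]). If u is empty, eta_u is almost surely
    constant, so all its covariances vanish ([covariance_H_set0]). The pairs
    left are the diagonal ones and those incomparable for inclusion, with u
    nonempty: these are exactly the terms in the numerators of the S_u
    ([sum_sets_incomparable]). Dividing by V(Y), which is finite and nonzero,
    gives 1. *)

Section distribution.
Context d d' (T : measurableType d) (T' : measurableType d') (R : realType).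
Variables (P : probability T R) (X : {RV P >-> T'}).

Lemma ae_distribution (Q : T' -> Prop) :
  {ae distribution P X, forall x, Q x} -> {ae P, forall w, Q (X w)}.
Proof.
move=> [N [mN PN QN]]; exists (X @^-1` N); split => //.
- by rewrite -[X in measurable X]setTI; exact: measurable_funPT.
- by move=> w /= nQ; apply: QN.
Qed.

Lemma Lfun_distribution (f : T' -> R) (r : R) :
  f \in Lfun (distribution P X) r%:E -> f \o X \in Lfun P r%:E.
Proof.
move=> /andP[/[!inE]/= mf].
rewrite /finite_norm unlock => ff.
apply/andP; split; rewrite inE /=.
  by apply: measurableT_comp.
rewrite /finite_norm unlock.
rewrite ge0_integral_distribution// in ff.
- apply: (measurableT_comp (measurable_poweR r)).
  by apply: measurableT_comp => //; exact/measurable_EFinP.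
- by move=> y; exact: poweR_ge0.
Qed.

End distribution.

Section covariance.
Context d (T : measurableType d) (R : realType) (P : probability T R).
Implicit Types f g h : T -> R.

Lemma Lfun2_Lfun1 f : f \in Lfun P 2%:E -> f \in Lfun P 1.
Proof. by apply: Lfun_subset12; exact: fin_num_measure. Qed.

Lemma covariance_Lfun2_fin_num f g :
  f \in Lfun P 2%:E -> g \in Lfun P 2%:E -> covariance P f g \is a fin_num.
Proof.
by move=> f2 g2; rewrite covariance_fin_num ?Lfun2_mul_Lfun1 ?Lfun2_Lfun1.
Qed.

Lemma ae_eq_expectation f g :
  measurable_fun setT f -> measurable_fun setT g ->
  {ae P, forall w, f w = g w} -> 'E_P[f]%E = 'E_P[g]%E.
Proof.
move=> mf mg fg; rewrite unlock; apply: ae_eq_integral => //.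
- exact/measurable_EFinP.
- exact/measurable_EFinP.
- by apply: filterS fg => w -> _.
Qed.

Lemma ae_eq_covariancel f g h :
  measurable_fun setT f -> measurable_fun setT g -> measurable_fun setT h ->
  {ae P, forall w, f w = g w} -> covariance P f h = covariance P g h.
Proof.
move=> mf mg mh fg; rewrite unlock (ae_eq_expectation mf mg fg).
apply: ae_eq_expectation.
- by apply: measurable_funM; apply: measurable_funB.
- by apply: measurable_funM; apply: measurable_funB.
- by apply: filterS fg => w fgw; rewrite !fctE /= fgw.
Qed.

Lemma covariance_suml (I : Type) (s : seq I) (F : I -> T -> R) h :
  (forall i, F i \in Lfun P 2%:E) -> h \in Lfun P 2%:E ->
  covariance P (\sum_(i <- s) F i) h = (\sum_(i <- s) covariance P (F i) h)%E.
Proof.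
move=> F2 h2; elim: s => [|i s IH]; first by rewrite !big_nil covariance_cst_l.
rewrite !big_cons covarianceDl ?IH//.
by rewrite rpred_sum// lee1n.
Qed.

Lemma variance_sum (I : Type) (s : seq I) (F : I -> T -> R) :
  (forall i, F i \in Lfun P 2%:E) ->
  'V_P[(\sum_(i <- s) F i)%R]%E =
  (\sum_(i <- s) \sum_(j <- s) covariance P (F i) (F j))%E.
Proof.
move=> F2; have S2 : \sum_(i <- s) F i \in Lfun P 2%:E.
  by rewrite rpred_sum// lee1n.
rewrite /variance covariance_suml//; apply: eq_bigr => i _.
rewrite covarianceC covariance_suml//.
by apply: eq_bigr => j _; rewrite covarianceC.
Qed.

End covariance.

Section orthogonality.
Context d (T : measurableType d) (R : realType) (P : probability T R) (p : nat).
Variable X : {RV P >-> p.-tuple R}.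
Implicit Types (u v : {set 'I_p}) (h : p.-tuple R -> R).

Lemma H0_H u h : H0 X u h -> H X u h.
Proof. by rewrite H0E => -[]. Qed.

Lemma H_Lfun2 u h : H X u h -> h \o X \in Lfun P 2%:E.
Proof. by move=> [h2 _]; exact: Lfun_distribution. Qed.

Lemma H_set0_cst (c : R) : H X finset.set0 (cst c).
Proof.
split; first exact: Lfun_cst.
by exists (cst c) => //; apply: aeW.
Qed.

(** R^0 is a single point, so functions of the empty subvector are a.s.
    constant. *)
Lemma covariance_H_set0 h (Y : T -> R) :
  H X finset.set0 h -> measurable_fun setT Y -> covariance P (h \o X) Y = 0%E.
Proof.
move=> Hh mY; have [h2 [g mg hg]] := Hh.
have mh : measurable_fun setT (h \o X).
  by move/H_Lfun2 : Hh => /andP[/[!inE]].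
(* Any value of the empty subvector will do as its only value. *)
pose t0 := coords finset.set0 (point : p.-tuple R).
rewrite -(covariance_cst_l P (g t0) Y); apply: ae_eq_covariancel => //.
apply: filterS (ae_distribution hg) => w /= ->; congr g.
by apply: eq_from_tnth => k; have := ltn_ord k; rewrite {2}cards0.
Qed.

(** The constant 1 lies in the component space of the empty set, so being
    centred is the instance of hierarchical orthogonality against 1. *)
Lemma expectation_H0 u h :
  u != finset.set0 -> H0 X u h -> 'E_P[h \o X]%E = 0%E.
Proof.
rewrite H0E => u0 [_ /(_ finset.set0)]; rewrite finset.proper0 => /(_ u0 (cst 1)).
rewrite H0_set0 => /(_ (H_set0_cst 1)); rewrite /inner.
suff -> : (h \o X) * (cst 1 \o X) = h \o X by [].
by apply/funext => w; rewrite !fctE mulr1.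
Qed.

(** The larger index set is nonempty, so its component is centred and the
    covariance is the inner product, which vanishes by definition. *)
Lemma covariance_H0_proper u v hu hv :
  v \proper u -> H0 X u hu -> H0 X v hv ->
  covariance P (hu \o X) (hv \o X) = 0%E.
Proof.
move=> vu Hu Hv; have hu2 := H_Lfun2 (H0_H Hu); have hv2 := H_Lfun2 (H0_H Hv).
rewrite covarianceE ?Lfun2_mul_Lfun1 ?Lfun2_Lfun1// (expectation_H0 _ Hu).
  by rewrite mul0e sube0; move: Hu; rewrite H0E => -[_ /(_ v vu hv Hv)].
by rewrite -finset.proper0; exact: sub_proper_trans (finset.sub0set _) vu.
Qed.

End orthogonality.

(** Pairs of sets are equal, nested or incomparable; only the nested ones and
    those with an empty first member are missing from the left-hand side. *)
Lemma sum_sets_incomparable (I : finType) (V : nmodType)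
    (c : {set I} -> {set I} -> V) :
  (forall v, c finset.set0 v = 0) ->
  (forall u v : {set I}, v \proper u -> c u v = 0) ->
  (forall u v : {set I}, u \proper v -> c u v = 0) ->
  \sum_(u : {set I} | u != finset.set0)
     (c u u + \sum_(v : {set I} | (u :&: v != u) && (u :&: v != v)) c u v) =
  \sum_(u : {set I}) \sum_(v : {set I}) c u v.
Proof.
move=> c0 cl cr; rewrite [RHS](bigD1 finset.set0)//= [X in _ = X + _]big1 ?add0r//.
apply: eq_bigr => u _; rewrite [RHS](bigD1 u)//=; congr (_ + _).
rewrite [RHS](bigID [pred v : {set I} | (u :&: v != u) && (u :&: v != v)])/=.
rewrite [X in _ = _ + X]big1 ?addr0.
  apply: eq_bigl => v; have [->|//] := eqVneq v u.
  by rewrite finset.setIid eqxx.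
move=> v /andP[vu]; rewrite negb_and !negbK.
move=> /orP[/eqP/finset.setIidPl uv|/eqP/finset.setIidPr vu'].
- by apply: cr; rewrite finset.properEneq eq_sym vu.
- by apply: cl; rewrite finset.properEneq vu.
Qed.

Theorem proposition2 (d : measure_display) (T : measurableType d)
  (R : realType) (P : probability T R) (p : nat) (p_ge1 : (1 <= p)%N)
  (X : {RV P >-> p.-tuple R})
  (nu : 'I_p -> {sigma_finite_measure set R -> \bar R})
  (PX_nu : distribution P X `<< product_measure nu)
  (M : R) (M_gt0 : 0 < M) (M_le1 : M <= 1)
  (density_ge : forall u : {set 'I_p},
    {ae product_measure nu, forall x : p.-tuple R,
      (M%:E * (marginal_density X nu (coords u x) *
               marginal_density X nu (coords (~: u) x))
       <= joint_density X nu x)%E})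
  (eta : p.-tuple R -> R)
  (eta_L2 : eta \in Lfun (distribution P X) 2%:E)
  (VY_neq0 : 'V_P[eta \o X] != 0%E)
  (eta_ : {set 'I_p} -> p.-tuple R -> R)
  (eta_decomposition : hoeffding_decomposition X eta eta_) :
  \sum_(u : {set 'I_p} | u != finset.set0) sensitivity_index X eta eta_ u = 1.
Proof.
have [eta_H0 etaE] := eta_decomposition.
have eta_2 u : eta_ u \o X \in Lfun P 2%:E := H_Lfun2 (H0_H (eta_H0 u)).
have Y2 : eta \o X \in Lfun P 2%:E := Lfun_distribution eta_L2.
have mLfun2 (f : T -> R) : f \in Lfun P 2%:E -> measurable_fun setT f.
  by move=> /andP[/[!inE]].
pose S : T -> R := \sum_(u : {set 'I_p}) (eta_ u \o X).
have S2 : S \in Lfun P 2%:E by rewrite rpred_sum// lee1n.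
have YS : {ae P, forall w, (eta \o X) w = S w}.
  by apply: filterS etaE => w /= ->; rewrite /S fct_sumE.
have VY : 'V_P[eta \o X]%E = 'V_P[S]%E.
  have [mY mS] := (mLfun2 _ Y2, mLfun2 _ S2).
  rewrite /variance (ae_eq_covariancel mY mS mY YS) covarianceC.
  exact: ae_eq_covariancel.
pose c u v := fine (covariance P (eta_ u \o X) (eta_ v \o X)).
have fineV : fine 'V_P[eta \o X]%E = \sum_u \sum_v c u v.
  rewrite VY variance_sum//.
  under eq_bigr do under eq_bigr do
    rewrite -[covariance _ _ _]fineK ?covariance_Lfun2_fin_num//.
  by under eq_bigr do rewrite sumEFin; rewrite sumEFin.
rewrite /sensitivity_index -mulr_suml.
rewrite [X in X / _](@sum_sets_incomparable _ _ c).
- by rewrite -fineV divff// fine_eq0 ?variance_fin_num.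
- move=> v; have Hv : H X finset.set0 (eta_ finset.set0) by exact: H0_H.
  by rewrite /c (covariance_H_set0 Hv (mLfun2 _ (eta_2 v))).
- by move=> u v vu; rewrite /c (covariance_H0_proper vu).
- by move=> u v uv; rewrite /c covarianceC (covariance_H0_proper uv).
Qed.
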